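(* Let $G_1=(V_1,E_1)$ and $G_2=(V_2,E_2)$ be finite simple graphs. Suppose $H_1$ is a path-intersecting subgraph of $G_1$, $H_2$ is a path-intersecting subgraph of $G_2$, and $\varphi\colon H_1\to H_2$ is a graph isomorphism. Let $G_1\bigoplus_{H_1}G_2$ be the subgraph sum of $G_1$ and $G_2$ along $H_1\cong H_2$. Then $$\chi\Big(G_1\bigoplus_{H_1}G_2,t\Big)=\frac{\chi(G_1,t)\,\chi(G_2,t)}{\chi(H_1,t)}.$$
   Context: All graphs are non-empty, finite, undirected and simple. The chromatic polynomial $\chi(G,t)$ of a graph $G$ is the polynomial such that for every integer $k\ge 0$, $\chi(G,k)$ is the number of proper colorings of $G$ with $k$ colors (adjacent vertices receive different colors). A subgraph $H=(V_H,E_H)$ of a graph $G$ is called path-intersecting if for every pair of vertices $v_i,v_j\in V_H$ that are non-adjacent in $H$, there is no path $P=(V_P,E_P)$ in $G$ between $v_i$ and $v_j$ such that $E_H\cap E_P=\emptyset$ and $V_H\cap V_P=\{v_i,v_j\}$. The subgraph sum $G_1\bigoplus_{H_1}G_2$ is the simple graph obtained from the disjoint union of $G_1$ and $G_2$ by identifying each vertex $v$ of $H_1$ with the vertex $\varphi(v)$ of $H_2$; its vertex set has cardinality $|V_1|+|V_2|-|V(H_2)|$ and its edge set is $E_1\cup E_2$ (with the edges of $H_1$ and $H_2$ identified via $\varphi$). *)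

(* Defs.v *)
From HB Require Import structures.
From mathcomp Require Import all_boot all_order all_algebra.

Set Implicit Arguments.
Unset Strict Implicit.
Unset Printing Implicit Defensive.

Import GRing.Theory.
Local Open Scope ring_scope.

Record sgraph := SGraph {
  vertex :> finType;
  adj : rel vertex;
  adj_sym : symmetric adj;
  adj_irr : irreflexive adj;
  sgraph_ne : (0 < #|vertex|)%N
}.

(* A subgraph is not assumed to be induced: its edges are any set of edges
   of [G] whose endpoints lie in [sub_vertices]. *)
Record subgraph (G : sgraph) := Subgraph {
  sub_vertices : {set G};
  sub_adj : rel G;
  sub_adj_sym : symmetric sub_adj;
  sub_adj_vertices :
    forall x y, sub_adj x y -> (x \in sub_vertices) && (y \in sub_vertices);
  sub_adj_adj : forall x y, sub_adj x y -> adj x y;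
  subgraph_ne : sub_vertices != set0
}.

Section GraphOfSubgraph.
Variables (G : sgraph) (H : subgraph G).

Definition sub_vertex := {x : G | x \in sub_vertices H}.

Definition sub_rel : rel sub_vertex := fun x y => sub_adj H (val x) (val y).

Lemma sub_rel_sym : symmetric sub_rel.
Proof. by move=> x y; apply: sub_adj_sym. Qed.

Lemma sub_rel_irr : irreflexive sub_rel.
Proof. by move=> x; apply/negP => /sub_adj_adj; rewrite adj_irr. Qed.

Lemma sub_vertex_ne : (0 < #|{: sub_vertex}|)%N.
Proof. by rewrite card_sig card_gt0 subgraph_ne. Qed.

Definition graph_of_subgraph : sgraph :=
  @SGraph sub_vertex sub_rel sub_rel_sym sub_rel_irr sub_vertex_ne.

End GraphOfSubgraph.

Coercion graph_of_subgraph : subgraph >-> sgraph.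

Record graph_iso (G H : sgraph) := GraphIso {
  iso_fun :> G -> H;
  iso_bij : bijective iso_fun;
  iso_adj : forall x y, adj (iso_fun x) (iso_fun y) = adj x y
}.

Section ChromaticPolynomial.
Variable G : sgraph.

Definition proper_coloring (k : nat) (f : {ffun G -> 'I_k}) : bool :=
  [forall x, forall y, adj x y ==> (f x != f y)].

Definition is_chromatic_poly (p : {poly int}) : Prop :=
  forall k : nat,
    p.[k%:R] = #|[set f : {ffun G -> 'I_k} | proper_coloring f]|%:R.

(* Existence: proper colorings are grouped by the map [c] sending a vertex to
   its color class; those with given [c] correspond to the injections from
   the set of color classes to the set of colors. *)
Let ker k (f : {ffun G -> 'I_k}) : {ffun G -> {set G}} :=
  [ffun x => [set y | f y == f x]].

Let valid (c : {ffun G -> {set G}}) : bool :=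
  [forall x, forall y, (y \in c x) == (c y == c x)] &&
  [forall x, forall y, adj x y ==> (c x != c y)].

Let ker_eq k (f : {ffun G -> 'I_k}) x y : (ker f y == ker f x) = (f y == f x).
Proof.
rewrite !ffunE; apply/eqP/eqP => [/setP/(_ y)|->//].
by rewrite !inE eqxx => /esym/eqP.
Qed.

Let kerP k (f : {ffun G -> 'I_k}) c :
  proper_coloring f && (ker f == c) =
  valid c && [forall x, forall y, (f x == f y) == (c x == c y)].
Proof.
apply/andP/andP => [[fP /eqP <-]|[/andP[/forallP cv /forallP cp] /forallP fc]].
  split; last by apply/forallP => x; apply/forallP => y; rewrite ker_eq.
  apply/andP; split; apply/forallP => x; apply/forallP => y.
    by rewrite ker_eq ffunE inE.
  by rewrite ker_eq; move/forallP/(_ x)/forallP: fP; apply.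
have fcE x y : (f x == f y) = (c x == c y) by have /forallP/(_ y)/eqP := fc x.
split.
  apply/forallP => x; apply/forallP => y; rewrite fcE.
  by move/forallP: (cp x); apply.
apply/eqP/ffunP => x; apply/setP => y; rewrite ffunE inE fcE.
by move/forallP: (cv x) => /(_ y)/eqP.
Qed.

Let card_ker k (c : {ffun G -> {set G}}) :
  #|[set f : {ffun G -> 'I_k} |
      [forall x, forall y, (f x == f y) == (c x == c y)]]| =
  (k ^_ #|c @: [set: G]|)%N.
Proof.
pose D := {B : {set G} | B \in c @: [set: G]}.
have cin x : c x \in c @: [set: G] by apply: imset_f; rewrite inE.
pose d x : D := exist _ (c x) (cin x).
have dsurj (B : D) : exists x, d x = B.
  case: B => B HB; have /imsetP[x _ Bx] := HB.
  by exists x; apply: val_inj; rewrite /= Bx.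
have -> : #|c @: [set: G]| = #|{: D}| by rewrite card_sig.
rewrite -[X in (X ^_ _)%N](card_ord k) -card_inj_ffuns.
pose F (g : {ffun D -> 'I_k}) : {ffun G -> 'I_k} := [ffun x => g (d x)].
have Finj : injective F.
  move=> g h /ffunP E; apply/ffunP => B; have [x <-] := dsurj B.
  by have := E x; rewrite !ffunE.
rewrite -(card_imset _ Finj); congr #|pred_of_set _|.
apply/setP => f; rewrite inE; apply/idP/imsetP.
  move=> /forallP fc.
  have fcE x y : (f x == f y) = (c x == c y).
    by have /forallP/(_ y)/eqP := fc x.
  have ex (B : D) : exists x, d x == B.
    by have [x <-] := dsurj B; exists x.
  exists [ffun B => f (xchoose (ex B))].
    rewrite inE; apply/injectiveP => A B; rewrite !ffunE => /eqP.
    rewrite fcE => /eqP E.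
    rewrite -(eqP (xchooseP (ex A))) -(eqP (xchooseP (ex B))).
    exact: val_inj.
  apply/ffunP => x; rewrite !ffunE; apply/eqP; rewrite fcE.
  by have /eqP/(congr1 val)/= -> := xchooseP (ex (d x)).
case=> g; rewrite inE => /injectiveP ginj ->.
apply/forallP => x; apply/forallP => y; rewrite !ffunE (inj_eq ginj).
by rewrite -val_eqE.
Qed.

Let ffact_poly (m k : nat) :
  (\prod_(j < m) ('X - (j%:R)%:P) : {poly int}).[k%:R] = ((k ^_ m)%N)%:R.
Proof.
elim: m => [|m IHm]; first by rewrite big_ord0 hornerE.
rewrite big_ord_recr hornerM IHm ffactnSr natrM !hornerE.
have [mk|km] := leqP m k; first by rewrite natrB.
by rewrite ffact_small // !mul0r.
Qed.

Lemma chromatic_poly_exists : {p : {poly int} | is_chromatic_poly p}.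
Proof.
exists (\sum_(c | valid c) \prod_(j < #|c @: [set: G]|) ('X - (j%:R)%:P)).
move=> k; rewrite horner_sum -sum1_card.
rewrite (partition_big (@ker k) predT) //= natr_sum [RHS]big_mkcond.
rewrite [LHS]big_mkcond; apply: eq_bigr => c _ /=.
rewrite sum1dep_card.
under eq_finset => f do rewrite inE kerP.
case: (valid c) => /=; first by rewrite ffact_poly card_ker.
by rewrite (_ : [set _ | _] = set0) ?cards0 //; apply/setP => f; rewrite !inE.
Qed.

Lemma is_chromatic_poly_uniq (p q : {poly int}) :
  is_chromatic_poly p -> is_chromatic_poly q -> p = q.
Proof.
move=> hp hq; apply/eqP; rewrite -subr_eq0; apply/negPn/negP => nz.
pose s := [seq (i%:R : int) | i <- iota 0 (size (p - q))].
have /(max_poly_roots nz) : all (root (p - q)) s.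
  apply/allP => _ /mapP[i _ ->].
  by rewrite rootE hornerD hornerN hp hq subrr.
rewrite size_map size_iota ltnn => H; suff: false by []; apply: H.
rewrite map_inj_uniq ?iota_uniq // => i j /eqP.
by rewrite Num.Theory.eqr_nat => /eqP.
Qed.

Definition chromatic_poly : {poly int} := sval chromatic_poly_exists.

Lemma chromatic_polyP : is_chromatic_poly chromatic_poly.
Proof. exact: (svalP chromatic_poly_exists). Qed.

Lemma chromatic_poly_neq0 : chromatic_poly != 0.
Proof.
apply/eqP => p0; have := chromatic_polyP #|G|; rewrite p0 horner0 => /esym/eqP.
rewrite Num.Theory.pnatr_eq0 cards_eq0 => /eqP/setP/(_ (finfun enum_rank)).
rewrite !inE => /negP[]; apply/forallP => x; apply/forallP => y.
apply/implyP => xy; rewrite !ffunE (inj_eq enum_rank_inj).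
by apply: contraTneq xy => ->; rewrite adj_irr.
Qed.

End ChromaticPolynomial.

(* A path is given by its first vertex [x] and the list [p] of the others. *)
Definition is_path (G : sgraph) (x y : G) (p : seq G) : Prop :=
  [/\ path (@adj G) x p, last x p = y & uniq (x :: p)].

Definition path_edges (T : Type) (x : T) (p : seq T) : seq (T * T) :=
  zip (x :: p) p.

(* The pair [x], [y] consists of distinct vertices: with [x = y] the one-vertex
   path would rule out every non-empty subgraph. *)
Definition path_intersecting (G : sgraph) (H : subgraph G) : Prop :=
  forall x y : G,
    x \in sub_vertices H -> y \in sub_vertices H -> x != y ->
    ~~ sub_adj H x y ->
    ~ exists p : seq G,
        [/\ is_path x y p,
            forall e, e \in path_edges x p -> ~~ sub_adj H e.1 e.2
          & sub_vertices H :&: [set z in x :: p] = [set x; y]].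

Section SubgraphSum.
Variables (G1 G2 : sgraph) (H1 : subgraph G1) (H2 : subgraph G2).
Variable phi : graph_iso H1 H2.

Definition disjoint_adj (u v : G1 + G2) : bool :=
  match u, v with
  | inl a, inl b => adj a b
  | inr a, inr b => adj a b
  | _, _ => false
  end.

Definition phi_related (a : G1) (b : G2) : bool :=
  [exists h : H1, (val h == a) && (val (phi h) == b)].

Definition glued (u v : G1 + G2) : bool :=
  match u, v with
  | inl a, inl b => a == b
  | inr a, inr b => a == b
  | inl a, inr b => phi_related a b
  | inr b, inl a => phi_related a b
  end.

Lemma phi_related_inj a b a' b' :
  phi_related a b -> phi_related a' b' -> (a == a') = (b == b').
Proof.
move=> /existsP[h /andP[/eqP<- /eqP<-]] /existsP[h' /andP[/eqP<- /eqP<-]].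
by rewrite !val_eqE (inj_eq (bij_inj (iso_bij phi))).
Qed.

Lemma glued_refl : reflexive glued.
Proof. by case=> a /=. Qed.

Lemma glued_sym : symmetric glued.
Proof. by case=> a [] b //=; rewrite eq_sym. Qed.

Lemma glued_trans : transitive glued.
Proof.
case=> b [] a [] c //=.
- by move=> /eqP->.
- by move=> /eqP->.
- by move=> ab /eqP<-.
- by move=> ab bc; rewrite -(phi_related_inj ab bc).
- by move=> ab bc; rewrite (phi_related_inj ab bc).
- by move=> ab /eqP<-.
- by move=> /eqP->.
- by move=> /eqP->.
Qed.

Canonical glued_equiv := EquivRel glued glued_refl glued_sym glued_trans.

Local Open Scope quotient_scope.

Definition sum_vertex := {eq_quot glued_equiv}.
HB.instance Definition _ := EqQuotient.on sum_vertex.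
HB.instance Definition _ := Choice.on sum_vertex.
HB.instance Definition _ : isCountable sum_vertex :=
  CanIsCountable (@reprK _ sum_vertex).
HB.instance Definition _ : isFinite sum_vertex :=
  CanIsFinite (@reprK _ sum_vertex).

Definition sum_adj (p q : sum_vertex) : bool :=
  [exists u, exists v,
    [&& \pi_sum_vertex u == p, \pi_sum_vertex v == q & disjoint_adj u v]].

Lemma sum_adj_sym : symmetric sum_adj.
Proof.
have dsym u v : disjoint_adj u v = disjoint_adj v u.
  by case: u v => a [] b //=; rewrite adj_sym.
suff sym p q : sum_adj p q -> sum_adj q p.
  by move=> p q; apply/idP/idP; apply: sym.
case/existsP=> u /existsP[v /and3P[up vq uv]].
by apply/existsP; exists v; apply/existsP; exists u; rewrite up vq dsym.
Qed.

Lemma glued_not_adj u v : glued u v -> disjoint_adj u v = false.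
Proof. by case: u v => a [] b //= /eqP->; rewrite adj_irr. Qed.

Lemma sum_adj_irr : irreflexive sum_adj.
Proof.
move=> p; case pp: (sum_adj p p) => //.
have /existsP[u /existsP[v /and3P[/eqP <-]]] := pp.
by rewrite eqmodE => vu; rewrite glued_not_adj // glued_sym.
Qed.

Lemma sum_vertex_ne : (0 < #|{: sum_vertex}|)%N.
Proof.
have /card_gt0P[a _] := sgraph_ne G1.
by apply/card_gt0P; exists (\pi_sum_vertex (inl a)).
Qed.

Definition subgraph_sum : sgraph :=
  @SGraph sum_vertex sum_adj sum_adj_sym sum_adj_irr sum_vertex_ne.

Lemma card_subgraph_sum :
  #|subgraph_sum| = (#|G1| + #|G2| - #|sub_vertices H2|)%N.
Proof.
pose D := [set u : G1 + G2 |
  if u is inr b then b \notin sub_vertices H2 else true].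
have related_in a b : phi_related a b -> b \in sub_vertices H2.
  by case/existsP => h /andP[_ /eqP<-]; apply: (valP (phi h)).
have injD : {in D &, injective (fun u => \pi_sum_vertex u)}.
  move=> u v; rewrite !inE => uD vD /eqP; rewrite eqmodE.
  case: u v uD vD => a [] b //= aD bD.
  - by move/eqP->.
  - by move/related_in; rewrite (negPf bD).
  - by move/related_in; rewrite (negPf aD).
  - by move/eqP->.
have surj (p : sum_vertex) : p \in [set \pi_sum_vertex u | u in D].
  rewrite -[p]reprK; case: (repr p) => [a|b].
    by apply: imset_f; rewrite inE.
  have [bH|bH] := boolP (b \in sub_vertices H2); last first.
    by apply: imset_f; rewrite inE.
  have [psi _ phiK] := iso_bij phi.
  pose h : H2 := exist _ b bH.
  apply/imsetP; exists (inl (val (psi h))); first by rewrite inE.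
  apply/eqP; rewrite eqmodE /=; apply/existsP; exists (psi h).
  by rewrite eqxx phiK eqxx.
have -> : #|subgraph_sum| = #|D|.
  rewrite -(card_in_imset injD) -cardsT; apply: eq_card => p.
  by rewrite surj inE.
have -> : #|sub_vertices H2| = #|~: D|.
  rewrite -(card_imset _ (@inr_inj G1 G2)); apply: eq_card => -[a|b].
    by rewrite !inE; apply/imsetP => -[].
  by rewrite !inE negbK mem_imset //; apply: inr_inj.
by rewrite -card_sum -(cardsC D) addnK.
Qed.

End SubgraphSum.

(* Main.v *)
Require Import Defs.
From mathcomp Require Import fingroup perm.
From mathcomp Require Import all_boot all_order all_algebra.

Import GRing.Theory.
Local Open Scope ring_scope.

(* Path-intersection says that [H] is induced and that the vertices of [H]
   adjacent to a given connected component of [G - H] form a clique.  Any two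
   proper colorings of [H] are injective on that clique, so a permutation of the
   colors carries one to the other there; applying one such permutation on each
   component turns extensions of the first coloring into extensions of the
   second.  Hence all proper colorings of [H] have the same number of extensions
   to [G].  A coloring of the sum is a pair of extensions of one coloring of
   [H], which gives the formula at every natural number. *)

(** * Preliminaries on polynomials and permutations *)

Lemma poly_eq_nat (p q : {poly int}) :
  (forall k : nat, p.[k%:R] = q.[k%:R]) -> p = q.
Proof.
move=> pq; apply/eqP; rewrite -subr_eq0; apply/negPn/negP => nz.
(* These are [size (p - q)] distinct roots, one more than the degree allows. *)
pose s := [seq (i%:R : int) | i <- iota 0 (size (p - q))].
have /(max_poly_roots nz) : all (root (p - q)) s.
  by apply/allP => _ /mapP[i _ ->]; rewrite rootE hornerD hornerN pq subrr.
rewrite size_map size_iota ltnn => H; suff: false by []; apply: H.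
rewrite map_inj_uniq ?iota_uniq // => i j /eqP.
by rewrite Num.Theory.eqr_nat => /eqP.
Qed.

(** Sending [f i] to [g i] is a partial injection of a finite type; it is extended to a permutation
    one index at a time. *)
Lemma perm_matching (I T : finType) (A : {set I}) (f g : I -> T) :
  {in A &, injective f} -> {in A &, injective g} ->
  exists s : {perm T}, {in A, forall i, s (f i) = g i}.
Proof.
move=> finj ginj.
suff [s sP] : exists s : {perm T}, {in enum A, forall i, s (f i) = g i}.
  by exists s => i iA; apply: sP; rewrite mem_enum.
have : {subset enum A <= A} by move=> i; rewrite mem_enum.
elim: (enum A) (enum_uniq A) => [_ _|a r IHr /= /andP[ar ur] sA].
  by exists 1%g.
have [i ir|s sP] := IHr ur; first by apply: sA; rewrite inE ir orbT.
have aA : a \in A by apply: sA; rewrite mem_head.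
(* The transposition corrects the value at [a]. It fixes each earlier [g i], which differs from
   [s (f a)] by injectivity of [f] and from [g a] by injectivity of [g]. *)
exists (s * tperm (s (f a)) (g a))%g => i; rewrite permM.
rewrite inE => /predU1P[->|ir]; first by rewrite tpermL.
have iA : i \in A by apply: sA; rewrite inE ir orbT.
have ai : a != i by apply: contraNneq ar => ->.
rewrite (sP i ir) tpermD //.
  by rewrite -(sP i ir) (inj_eq perm_inj); apply: contra_neq ai; apply: finj.
by apply: contra_neq ai; apply: ginj.
Qed.

Lemma proper_coloringP (G : sgraph) (k : nat) (f : {ffun G -> 'I_k}) :
  reflect (forall x y, adj x y -> f x != f y) (proper_coloring f).
Proof.
apply: (iffP forallP) => [fP x y xy|fP x].
  by have /forallP/(_ y)/implyP := fP x; apply.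
by apply/forallP => y; apply/implyP; apply: fP.
Qed.

(** * Components of [G - H] and their attachment to [H] *)

Section Extensions.
Context {G : sgraph} (H : subgraph G).

Definition outside : rel G := [rel x y |
  [&& x \notin sub_vertices H, y \notin sub_vertices H & adj x y]].

Definition attached (x : G) : {set G} :=
  [set a in sub_vertices H | [exists y, connect outside x y && adj y a]].

Lemma outside_connect_sym : connect_sym outside.
Proof.
apply: sym_connect_sym => x y.
by rewrite /outside /= adj_sym andbCA.
Qed.

Lemma attached_adj x y : outside x y -> attached x = attached y.
Proof.
move=> /connect1 xy; apply/setP => a; rewrite !inE.
congr (_ && _); apply: eq_existsb => z.
by rewrite (same_connect outside_connect_sym xy).
Qed.

Lemma path_outside x p : x \notin sub_vertices H -> path outside x p ->
  path (@adj G) x p /\ all (fun z => z \notin sub_vertices H) (x :: p).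
Proof.
elim: p x => [|y p IHp] x xH /=; first by rewrite xH.
case/andP => /and3P[_ yH xy] /(IHp _ yH)[-> /= ->].
by rewrite xH xy.
Qed.

Section PathIntersecting.
Hypothesis hH : path_intersecting H.

(** An edge of [G] missing from [H] would itself be a forbidden path. *)
Lemma path_intersecting_induced x y :
  x \in sub_vertices H -> y \in sub_vertices H -> adj x y -> sub_adj H x y.
Proof.
move=> xH yH xy; apply/negPn/negP => nxy.
have xNy : x != y by apply: contraTneq xy => ->; rewrite adj_irr.
apply: (hH _ _ xH yH xNy nxy); exists [:: y]; split.
- by split; rewrite //= ?xy // inE xNy.
- by move=> e; rewrite inE => /eqP->.
- by apply/setP => z; rewrite !inE; case: eqP => [->|_]; case: eqP => [->|_];
    rewrite ?xH ?yH ?andbF.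
Qed.

(** If [a] and [b] were not adjacent in [H], a path from [a] through the component of [x] to [b]
    would meet [H] only at its ends, which is forbidden. *)
Lemma attached_clique x a b : x \notin sub_vertices H ->
  a \in attached x -> b \in attached x -> a != b -> sub_adj H a b.
Proof.
move=> xH; rewrite !inE => /andP[aH /existsP[y /andP[xy ya]]].
move=> /andP[bH /existsP[z /andP[xz zb]]] ab; apply/negPn/negP => nab.
have out w : connect outside x w -> w \notin sub_vertices H.
  case/connectP => p /path_outside-/(_ xH)[_ /allP pH] ->.
  by apply: pH; apply: mem_last.
have : connect outside y z.
  by rewrite (connect_trans _ xz) // outside_connect_sym.
case/connectP => p0 yp0 Ez; move: zb; rewrite {}Ez.
case/shortenP: yp0 => p yp up _ zb.
have [{}yp pH] := path_outside _ _ (out _ xy) yp.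
have memp w : w \in sub_vertices H -> w \notin y :: p.
  by move=> wH; apply: contraL wH; apply: (allP pH).
apply: (hH _ _ aH bH ab nab); exists (rcons (y :: p) b); split.
- split; last 1 first.
  + by rewrite cons_uniq rcons_uniq mem_rcons in_cons negb_or ab !memp.
  + by rewrite rcons_path /= yp zb adj_sym ya.
  + by rewrite last_rcons.
(* Every edge of the path has an endpoint outside [H], so none belongs to [H]. *)
- have edgeH u q : all (fun z => z \notin sub_vertices H) q ->
      u \notin sub_vertices H ->
      forall e, e \in path_edges u (rcons q b) -> ~~ sub_adj H e.1 e.2.
    elim: q u => [|v q IHq] u /=.
      move=> _ uH e; rewrite inE => /eqP-> /=.
      by apply: contra uH => /sub_adj_vertices/andP[].
    move=> /andP[vH qH] uH e; rewrite inE => /predU1P[->|] /=.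
      by apply: contra uH => /sub_adj_vertices/andP[].
    exact: IHq.
  move: pH => /= /andP[yH pH] e; rewrite inE => /predU1P[->|] /=.
    by apply: contra yH => /sub_adj_vertices/andP[].
  exact: edgeH.
- apply/setP => w; rewrite in_setI in_set2 in_set in_cons mem_rcons in_cons.
  have [wH|wH] := boolP (w \in sub_vertices H).
    by rewrite (negPf (memp _ wH)) orbF.
  by apply/esym/norP; split; apply: contraNneq wH => ->.
Qed.

End PathIntersecting.

(** * Transporting extensions from one coloring of [H] to another *)

Section Colorings.
Context {k : nat}.
Implicit Types (f : {ffun G -> 'I_k}) (h : {ffun H -> 'I_k}).

Definition restrict f : {ffun H -> 'I_k} := [ffun v : H => f (val v)].

Definition extensions h := [set f | proper_coloring f & restrict f == h].

Lemma restrict_proper f : proper_coloring f -> proper_coloring (restrict f).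
Proof.
move=> /proper_coloringP fP; apply/proper_coloringP => u v uv; rewrite !ffunE.
by apply: fP; apply: sub_adj_adj uv.
Qed.

(** The choice depends on [x] only through [attached x], so it is constant on each component of
    [G - H]. For proper [h], [h'] and [x] outside a path-intersecting [H] a suitable permutation
    exists, and the default is not reached. *)
Definition recolor h h' (x : G) : {perm 'I_k} :=
  odflt 1%g [pick s : {perm 'I_k} |
    [forall v : H, (val v \in attached x) ==> (s (h v) == h' v)]].

Definition transport h h' f : {ffun G -> 'I_k} :=
  [ffun x => if (insub x : option (sub_vertex H)) is Some v then h' v
             else recolor h h' x (f x)].

Hypothesis hH : path_intersecting H.

Lemma recolorE h h' x (v : H) : proper_coloring h -> proper_coloring h' ->
  x \notin sub_vertices H -> val v \in attached x ->
  recolor h h' x (h v) = h' v.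
Proof.
move=> hP h'P xH vx; rewrite /recolor.
case: pickP => [s /forallP/(_ v)/implyP/(_ vx)/eqP //|none].
pose A := [set v : H | val v \in attached x].
have inj (g : {ffun H -> 'I_k}) : proper_coloring g -> {in A &, injective g}.
  move=> /proper_coloringP gP u w.
  rewrite [u \in A]in_set [w \in A]in_set => ux wx /eqP guw.
  apply/eqP; apply: contraLR guw => uw; apply: gP.
  exact: (attached_clique hH x (val u) (val w) xH ux wx uw).
have [s sP] := perm_matching _ _ A h h' (inj h hP) (inj h' h'P).
have /forallP[] := none s => w; apply/implyP => wx.
by rewrite sP // in_set.
Qed.

Lemma transport_extensions h h' f :
  proper_coloring h -> proper_coloring h' ->
  f \in extensions h -> transport h h' f \in extensions h'.
Proof.
move=> hP h'P; rewrite !inE => /andP[/proper_coloringP fP /eqP fh].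
have inH (v : sub_vertex H) : transport h h' f (val v) = h' v.
  by rewrite ffunE valK.
have outH x : x \notin sub_vertices H ->
    transport h h' f x = recolor h h' x (f x).
  by move=> xH; rewrite ffunE insubN.
apply/andP; split; last by apply/eqP/ffunP => v; rewrite ffunE inH.
have mixed x y : x \in sub_vertices H -> y \notin sub_vertices H -> adj x y ->
    transport h h' f x != transport h h' f y.
  move=> xH yH xy; pose v : sub_vertex H := exist _ x xH.
  (* Writing [h' v] as the image of [h v = f x] under the permutation at [y] reduces the claim to
     [f x != f y]. *)
  rewrite (inH v) (outH _ yH) -(recolorE h h' y v hP h'P yH); last first.
    by rewrite inE xH; apply/existsP; exists y; rewrite connect0 adj_sym.
  by rewrite (inj_eq perm_inj) -fh ffunE fP.
apply/proper_coloringP => x y xy.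
have [xH|xH] := boolP (x \in sub_vertices H);
have [yH|yH] := boolP (y \in sub_vertices H).
- have := inH (exist _ x xH); have := inH (exist _ y yH) => /= -> ->.
  by apply: (proper_coloringP _ _ _ h'P); apply: (path_intersecting_induced hH).
- exact: mixed.
- by rewrite eq_sym mixed // adj_sym.
(* Both endpoints lie in one component and are recolored by the same permutation. *)
- rewrite !outH // /recolor (attached_adj x y) ?(inj_eq perm_inj) ?fP //.
  by rewrite /outside /= xH yH.
Qed.

(** Transport is injective on extensions of [h]: they agree on [H], and outside [H] the permutation
    applied at a vertex does not depend on the extension. *)
Lemma leq_card_extensions h h' : proper_coloring h -> proper_coloring h' ->
  (#|extensions h| <= #|extensions h'|)%N.
Proof.
move=> hP h'P; rewrite -(card_in_imset (f := transport h h')).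
  apply/subset_leq_card/subsetP => _ /imsetP[f fh ->].
  exact: transport_extensions.
move=> f g; rewrite !inE => /andP[_ /eqP fh] /andP[_ /eqP gh] /ffunP E.
apply/ffunP => x; have [xH|xH] := boolP (x \in sub_vertices H).
  have /ffunP/(_ (exist _ x xH)) := etrans fh (esym gh).
  by rewrite !ffunE.
by have := E x; rewrite !ffunE insubN // => /perm_inj.
Qed.

Lemma card_extensions_const :
  exists c, forall h, proper_coloring h -> #|extensions h| = c.
Proof.
have [h0 h0P|none] := pickP (@proper_coloring H k); last first.
  (* Without proper colorings of [H] the claim is vacuous and the value arbitrary. *)
  by exists 0%N => h; rewrite none.
exists #|extensions h0| => h hP.
by apply/eqP; rewrite eqn_leq !leq_card_extensions.
Qed.

End Colorings.
End Extensions.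

(** * Counting colorings by restriction and across isomorphisms *)

Definition num_colorings (G : sgraph) (k : nat) :=
  #|[set f : {ffun G -> 'I_k} | proper_coloring f]|.

Lemma num_colorings_extensions (G : sgraph) (H : subgraph G) (k c : nat) :
  (forall h : {ffun H -> 'I_k}, proper_coloring h -> #|extensions H h| = c) ->
  num_colorings G k = (num_colorings H k * c)%N.
Proof.
move=> cP; rewrite /num_colorings -sum1_card.
rewrite (partition_big (restrict H) (mem [set h | proper_coloring h])) /=.
  rewrite -sum_nat_const; apply: eq_bigr => h; rewrite inE => hP.
  by rewrite -(cP h hP) -sum1_card; apply: eq_bigl => f; rewrite !inE.
by move=> f; rewrite !inE; apply: restrict_proper.
Qed.

Section Iso.
Context {G H : sgraph} (phi : graph_iso G H) {k : nat}.

Definition pull_coloring (h : {ffun H -> 'I_k}) : {ffun G -> 'I_k} :=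
  [ffun v => h (phi v)].

Lemma pull_coloring_bij : bijective pull_coloring.
Proof.
have [psi phiK psiK] := iso_bij phi.
exists (fun h : {ffun G -> 'I_k} => [ffun w => h (psi w)]) => h;
  by apply/ffunP => v; rewrite !ffunE ?phiK ?psiK.
Qed.

Lemma pull_coloring_proper h :
  proper_coloring (pull_coloring h) = proper_coloring h.
Proof.
have [psi phiK psiK] := iso_bij phi.
apply/proper_coloringP/proper_coloringP => hP x y.
  by rewrite -[x]psiK -[y]psiK iso_adj => /hP; rewrite !ffunE.
by rewrite -(iso_adj phi) !ffunE => /hP.
Qed.

Lemma num_colorings_iso : num_colorings G k = num_colorings H k.
Proof.
rewrite /num_colorings -[RHS](card_imset _ (bij_inj pull_coloring_bij)).
apply: eq_card => h; rewrite inE; have [q qK Kq] := pull_coloring_bij.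
apply/idP/imsetP => [hP|[h' + ->]]; last by rewrite inE pull_coloring_proper.
by exists (q h); rewrite ?inE -?pull_coloring_proper Kq.
Qed.

End Iso.

(** * Colorings of the subgraph sum *)

Section Sum.
Context {G1 G2 : sgraph} {H1 : subgraph G1} {H2 : subgraph G2}.
Context (phi : graph_iso H1 H2) {k : nat}.
Local Open Scope quotient_scope.
Let S := subgraph_sum phi.
Let pi (u : G1 + G2) : S := \pi_(sum_vertex phi) u.

Definition sum_split (f : {ffun S -> 'I_k}) :
    {ffun G1 -> 'I_k} * {ffun G2 -> 'I_k} :=
  ([ffun a => f (pi (inl a))], [ffun b => f (pi (inr b))]).

Definition compatible_pairs :=
  [set g : {ffun G1 -> 'I_k} * {ffun G2 -> 'I_k} |
    [&& proper_coloring g.1, proper_coloring g.2 &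
        restrict H1 g.1 == pull_coloring phi (restrict H2 g.2)]].

Lemma sum_split_inj : injective sum_split.
Proof.
move=> f g [/ffunP E1 /ffunP E2]; apply/ffunP => p.
rewrite -[p](reprK (p : sum_vertex phi)); case: (repr (p : sum_vertex phi)) => [a|b].
  by have := E1 a; rewrite !ffunE.
by have := E2 b; rewrite !ffunE.
Qed.

Lemma sum_adjP (p q : S) :
  reflect (exists u v, [/\ pi u = p, pi v = q & disjoint_adj u v]) (adj p q).
Proof.
apply: (iffP existsP) => [[u /existsP[v /and3P[/eqP<- /eqP<- uv]]]|].
  by exists u, v.
case=> u [v [<- <- uv]]; exists u; apply/existsP; exists v.
by rewrite !eqxx.
Qed.

Lemma sum_split_image :
  [set sum_split f | f in [set f | proper_coloring f]] = compatible_pairs.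
Proof.
apply/setP => -[g1 g2]; rewrite !inE /=; apply/imsetP/and3P.
  case=> f; rewrite inE => /proper_coloringP fP [-> ->]; split.
  - apply/proper_coloringP => x y xy; rewrite !ffunE; apply: fP.
    by apply/sum_adjP; exists (inl x), (inl y).
  - apply/proper_coloringP => x y xy; rewrite !ffunE; apply: fP.
    by apply/sum_adjP; exists (inr x), (inr y).
  - apply/eqP/ffunP => v; rewrite !ffunE; congr (f _).
    by apply/eqP; rewrite eqmodE /=; apply/existsP; exists v; rewrite !eqxx.
case=> /proper_coloringP g1P /proper_coloringP g2P /eqP/ffunP g12.
pose g (u : G1 + G2) := match u with inl a => g1 a | inr b => g2 b end.
have g_related a b : phi_related phi a b -> g1 a = g2 b.
  case/existsP => v /andP[/eqP<- /eqP<-].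
  by have := g12 v; rewrite !ffunE.
have g_glued u v : glued phi u v -> g u = g v.
  by case: u v => a [] b /= => [/eqP->|/g_related|/g_related|/eqP->].
(* The choice of representative is harmless, since [g] is constant on glued classes. *)
pose f : {ffun S -> 'I_k} := [ffun p : S => g (repr (p : sum_vertex phi))].
have fpi u : f (pi u) = g u.
  by rewrite ffunE; apply: g_glued; rewrite -[glued _ _ _]eqmodE reprK.
exists f; last by congr pair; apply/ffunP => x; rewrite ffunE fpi.
rewrite inE; apply/proper_coloringP => p q /sum_adjP[u [v [<- <-]]].
by rewrite !fpi; case: u v => a [] b //=; [apply: g1P | apply: g2P].
Qed.

(** Compatible pairs are grouped by their restriction [h] to [H2]; each fibre is the product of the
    extensions of [pull_coloring phi h] and of [h]. *)
Lemma num_colorings_sum (c1 c2 : nat) :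
  (forall h : {ffun H1 -> 'I_k}, proper_coloring h -> #|extensions H1 h| = c1) ->
  (forall h : {ffun H2 -> 'I_k}, proper_coloring h -> #|extensions H2 h| = c2) ->
  num_colorings S k = (num_colorings H2 k * (c1 * c2))%N.
Proof.
move=> c1P c2P; rewrite /num_colorings -(card_imset _ sum_split_inj).
rewrite sum_split_image -sum1_card.
rewrite (partition_big (fun g => restrict H2 g.2)
  (mem [set h | proper_coloring h])) /=; last first.
  by move=> g; rewrite !inE => /and3P[_ /restrict_proper].
rewrite -sum_nat_const; apply: eq_bigr => h; rewrite inE => hP.
rewrite -(c1P (pull_coloring phi h)) ?pull_coloring_proper //.
rewrite -(c2P h hP) -cardsX -sum1_card; apply: eq_bigl => -[g1 g2].
rewrite !inE /=; case: (restrict H2 g2 =P h) => [->|_]; last by rewrite !andbF.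
by rewrite !andbT -andbA [X in _ && X]andbC.
Qed.

End Sum.

(* The quotient is taken in the field of fractions of Z[t]. *)
Theorem theorem3p5 (G1 G2 : sgraph) (H1 : subgraph G1) (H2 : subgraph G2)
    (hH1 : path_intersecting H1) (hH2 : path_intersecting H2)
    (phi : graph_iso H1 H2) :
  tofrac (chromatic_poly (subgraph_sum phi)) =
    tofrac (chromatic_poly G1) * tofrac (chromatic_poly G2) / tofrac (chromatic_poly H1)
    :> {fraction {poly int}}.
Proof.
apply: canRL (mulfK _) _; first by rewrite tofrac_eq0 chromatic_poly_neq0.
rewrite -!rmorphM; congr tofrac; apply: poly_eq_nat => k.
rewrite !hornerM !chromatic_polyP -!natrM; congr (_%:R).
have [c1 c1P] := card_extensions_const H1 (k := k) hH1.
have [c2 c2P] := card_extensions_const H2 (k := k) hH2.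
rewrite -!/(num_colorings _ k) (num_colorings_sum phi c1 c2 c1P c2P).
rewrite (num_colorings_extensions _ _ _ _ c1P).
rewrite (num_colorings_extensions _ _ _ _ c2P) (num_colorings_iso phi).
(* With [n] colorings of [H2], this is [n * (c1 * c2) * n = (n * c1) * (n * c2)]. *)
by rewrite mulnC mulnACA mulnA.
Qed.
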